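(* Let $p=2$ and $\mathbf X=(X_1,X_2)$. Assume that $P_X \ll \nu$, where $\nu(dx)=\nu_1(dx_1)\otimes\nu_2(dx_2)$, and that there exists $0<M\le 1$ such that for every $u\subseteq \{1,2\}$, $p_X \ge M\, p_{X_u}p_{X_{u^c}}$ $\nu$-a.e. Let $\eta$ be any function of $L^2_{\mathbb R}(\mathbb R^2,\mathcal B(\mathbb R^2),P_X)$. Then the linear system $$(\mathcal S)\qquad\begin{pmatrix} \mathrm{Id} & 0 & 0 & 0 \\ 0 & \mathrm{Id} & P_{H_1^0} & 0 \\ 0 & P_{H_2^0} & \mathrm{Id} & 0 \\ 0 & 0 & 0 & \mathrm{Id} \end{pmatrix} \begin{pmatrix} h_0 \\ h_1 \\ h_2 \\ h_{12} \end{pmatrix} = \begin{pmatrix} P_{H_\emptyset}(\eta) \\ P_{H_1^0}(\eta) \\ P_{H_2^0}(\eta) \\ P_{H_{12}^0}(\eta) \end{pmatrix}$$ admits, in $h=(h_0,h_1,h_2,h_{12})\in H_\emptyset\times H_1^0\times H_2^0\times H_{12}^0$, the unique solution $h^*=(\eta_0,\eta_1,\eta_2,\eta_{12})$, the components of the hierarchically orthogonal decomposition of $\eta$.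
   Context: $\mathbf X=(X_1,X_2)$ is a random vector in $\mathbb R^2$ with law $P_X$; $\nu$ is a $\sigma$-finite measure on $\mathbb R^2$ and $p_X=dP_X/d\nu$. For $u\subseteq\{1,2\}$, $X_u=(X_l)_{l\in u}$, $u^c=\{1,2\}\setminus u$, and $p_{X_u}$ is the marginal density of $X_u$ with respect to $\bigotimes_{l\in u}\nu_l$ (with $p_{X_\emptyset}=1$). The inner product of $L^2_{\mathbb R}(\mathbb R^2,\mathcal B(\mathbb R^2),P_X)$ is $\langle h_1,h_2\rangle=\mathbb E(h_1(\mathbf X)h_2(\mathbf X))$. Functions are identified when equal $P_X$-a.s. $H_u$ is the subspace of square integrable measurable functions depending only on $X_u$; $H_\emptyset$ is the set of constants and $H_\emptyset^0=H_\emptyset$. For nonempty $u$, recursively, $$H_u^0=\{h_u(X_u)\in H_u:\ \langle h_u,h_v\rangle=0\ \ \forall v\subset u,\ \forall h_v\in H_v^0\},$$ where $\subset$ denotes strict inclusion. One writes $H_1^0,H_2^0,H_{12}^0$ for $u=\{1\},\{2\},\{1,2\}$. $P_{H_u^0}$ is the orthogonal projection onto $H_u^0$, and $P_{H_\emptyset}$ that onto $H_\emptyset$. Hierarchically orthogonal decomposition: under the assumptions of the claim there is a unique family $(\eta_0,\eta_1,\eta_2,\eta_{12})\in H_\emptyset\times H_1^0\times H_2^0\times H_{12}^0$ with $\eta(X_1,X_2)=\eta_0+\eta_1(X_1)+\eta_2(X_2)+\eta_{12}(X_1,X_2)$. *)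

(* Defs.v *)
(* MathComp-Analysis. *)
From HB Require Import structures.
From mathcomp Require Import all_boot all_order all_algebra.
From mathcomp Require Import all_classical all_reals all_analysis.

Set Implicit Arguments.
Unset Strict Implicit.
Unset Printing Implicit Defensive.

Import Order.TTheory GRing.Theory Num.Theory.
Import numFieldNormedType.Exports.

Local Open Scope classical_set_scope.
Local Open Scope charge_scope.
Local Open Scope ring_scope.

(* The index set {1, 2} is 'I_2: the index 1 is ord0 and the index 2 is
   ord_max. *)
Definition s1 : {set 'I_2} := finset.set1 ord0.
Definition s2 : {set 'I_2} := finset.set1 ord_max.
Definition s12 : {set 'I_2} := [set: 'I_2]%SET.
Definition sempty : {set 'I_2} := finset.set0.

Notation plane R := (measurableTypeR R * measurableTypeR R)%type.

Definition coord (R : realType) (x : plane R) (l : 'I_2) : R :=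
  if l == ord0 then x.1 else x.2.

Definition coord1 (R : realType) (x : plane R) : measurableTypeR R := x.1.
Definition coord2 (R : realType) (x : plane R) : measurableTypeR R := x.2.

HB.instance Definition _ (R : realType) :=
  isMeasurableFun.Build _ _ _ _ (@coord1 R) measurable_fst.
HB.instance Definition _ (R : realType) :=
  isMeasurableFun.Build _ _ _ _ (@coord2 R) measurable_snd.

(* The product measure under an alias: the sigma-finite structure that can be
   inferred for nu1 \x nu2 itself only covers subprobabilities. *)
Definition nu_prod d1 d2 (T1 : measurableType d1)
    (T2 : measurableType d2) (R : realType)
    (nu1 : {sigma_finite_measure set T1 -> \bar R})
    (nu2 : {sigma_finite_measure set T2 -> \bar R}) :
  set (T1 * T2) -> \bar R := (nu1 \x nu2)%E.

HB.instance Definition _ d1 d2 (T1 : measurableType d1)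
    (T2 : measurableType d2) (R : realType)
    (nu1 : {sigma_finite_measure set T1 -> \bar R})
    (nu2 : {sigma_finite_measure set T2 -> \bar R}) :=
  Measure.copy (nu_prod nu1 nu2) (nu1 \x nu2)%E.

Lemma nu_prod_sigma_finite d1 d2 (T1 : measurableType d1)
    (T2 : measurableType d2) (R : realType)
    (nu1 : {sigma_finite_measure set T1 -> \bar R})
    (nu2 : {sigma_finite_measure set T2 -> \bar R}) :
  sigma_finite setT (nu_prod nu1 nu2).
Proof.
have /sigma_finiteP[F [TF ndF Foo]] := sigma_finiteT nu1.
have /sigma_finiteP[G [TG ndG Goo]] := sigma_finiteT nu2.
exists (fun n => F n `*` G n).
  rewrite -setXTT TF TG predeqE => -[x y]; split.
    move=> [/= [n _ Fnx] [k _ Gky]]; exists (maxn n k) => //; split.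
    - by move: x Fnx; exact/subsetPset/ndF/leq_maxl.
    - by move: y Gky; exact/subsetPset/ndG/leq_maxr.
  by move=> [n _ []/= ? ?]; split; exists n.
move=> k; have [mF Fk] := Foo k; have [mG Gk] := Goo k.
split; first exact: measurableX.
by rewrite /nu_prod product_measure1E// lte_mul_pinfty// ge0_fin_numE.
Qed.

HB.instance Definition _ d1 d2 (T1 : measurableType d1)
    (T2 : measurableType d2) (R : realType)
    (nu1 : {sigma_finite_measure set T1 -> \bar R})
    (nu2 : {sigma_finite_measure set T2 -> \bar R}) :=
  Measure_isSigmaFinite.Build _ _ _ (nu_prod nu1 nu2)
    (nu_prod_sigma_finite nu1 nu2).

(* The density p_{X_u}, read as a function on the whole plane.  Each marginal
   law is the law of X_u, and its density is the Radon-Nikodym derivative with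
   respect to the product of the nu_l, l \in u. *)
Definition marginal_density d (Omega : measurableType d) (R : realType)
    (P : probability Omega R) (X : {RV P >-> plane R})
    (nu1 nu2 : {sigma_finite_measure set (measurableTypeR R) -> \bar R})
    (u : {set 'I_2}) (x : plane R) : \bar R :=
  match ord0 \in u, ord_max \in u with
  | true, true =>
      ('d (charge_of_finite_measure (distribution P X)) '/d (nu_prod nu1 nu2)) x
  | true, false =>
      ('d (charge_of_finite_measure
             (distribution (distribution P X) (@coord1 R))) '/d nu1) x.1
  | false, true =>
      ('d (charge_of_finite_measure
             (distribution (distribution P X) (@coord2 R))) '/d nu2) x.2
  | false, false => 1%E
  end.

Definition inner d (Omega : measurableType d) (R : realType)
    (P : probability Omega R) (X : {RV P >-> plane R})
    (h k : plane R -> R) : R :=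
  fine ('E_P[fun w => (h (X w) * k (X w))%R])%E.

(* Elements of L^2 are represented by functions, not by classes; identification
   up to P_X-a.s. equality is made explicit wherever functions are compared. *)
Definition H d (Omega : measurableType d) (R : realType)
    (P : probability Omega R) (X : {RV P >-> plane R})
    (u : {set 'I_2}) : set (plane R -> R) :=
  [set h | h \in Lfun (distribution P X) 2%:E /\
     forall x y : plane R,
       (forall l, l \in u -> coord x l = coord y l) -> h x = h y].

(* The recursion over strict subsets is run on a bound n on the cardinal of u;
   H0E below is the defining equation. *)
Fixpoint H0_rec d (Omega : measurableType d) (R : realType)
    (P : probability Omega R) (X : {RV P >-> plane R})
    (n : nat) (u : {set 'I_2}) : set (plane R -> R) :=
  match n with
  | 0%N => H X u
  | n'.+1 => [set h | H X u h /\
      forall v : {set 'I_2}, v \proper u ->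
        forall k, H0_rec X n' v k -> inner X h k = 0]
  end.

Definition H0 d (Omega : measurableType d) (R : realType)
    (P : probability Omega R) (X : {RV P >-> plane R})
    (u : {set 'I_2}) : set (plane R -> R) :=
  H0_rec X #|u| u.

Lemma H0_recE d (Omega : measurableType d) (R : realType)
    (P : probability Omega R) (X : {RV P >-> plane R})
    (n : nat) (u : {set 'I_2}) : (#|u| <= n)%N -> H0_rec X n u = H0 X u.
Proof.
have [m] := ubnP n; elim: m n u => // m IH n u nm un; rewrite /H0.
case: n nm un => [|n] nm un; first by move: un; rewrite leqn0 => /eqP ->.
case E : #|u| => [|k] /=.
  apply/seteqP; split=> [h []//|h Hh]; split=> // v /proper_card.
  by rewrite E.
have vk (v : {set 'I_2}) : v \proper u -> (#|v| <= k)%N /\ (#|v| <= n)%N.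
  by move=> /proper_card; rewrite E ltnS => vk; split=> //;
    apply: (leq_trans vk); move: un; rewrite E ltnS.
have kn : (k <= n)%N by move: un; rewrite E.
apply/seteqP; split=> h [Hh hv]; split=> // v vu f fv; apply: (hv v vu);
  have [v1 v2] := vk v vu; move: fv; rewrite !IH//;
  by apply: leq_ltn_trans kn _.
Qed.

Lemma H0E d (Omega : measurableType d) (R : realType)
    (P : probability Omega R) (X : {RV P >-> plane R}) (u : {set 'I_2}) :
  H0 X u = [set h | H X u h /\
    forall v : {set 'I_2}, v \proper u ->
      forall k, H0 X v k -> inner X h k = 0].
Proof.
rewrite -(@H0_recE _ _ _ _ X #|u|.+1)//=.
by apply/seteqP; split=> h [Hh hv]; split=> // v vu k kv; apply: (hv v vu);
  move: kv; rewrite H0_recE//; exact/ltnW/proper_card.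
Qed.

(* The orthogonal projection of f on a subspace K: the element g of K with
   f - g orthogonal to K, which is unique up to P_X-a.s. equality; one
   representative is picked.  The default value is only reached when f has no
   orthogonal projection on K. *)
Definition proj d (Omega : measurableType d) (R : realType)
    (P : probability Omega R) (X : {RV P >-> plane R})
    (K : set (plane R -> R)) (f : plane R -> R) : plane R -> R :=
  xget (cst 0) [set g | K g /\ forall k, K k -> inner X (f \- g) k = 0].

Record components (R : realType) := Components {
  c0 : plane R -> R ;
  c1 : plane R -> R ;
  c2 : plane R -> R ;
  c12 : plane R -> R }.

Definition in_H0_product d (Omega : measurableType d) (R : realType)
    (P : probability Omega R) (X : {RV P >-> plane R}) (h : components R) : Prop :=
  [/\ H X sempty (c0 h), H0 X s1 (c1 h), H0 X s2 (c2 h) & H0 X s12 (c12 h)].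

Definition components_ae_eq d (Omega : measurableType d) (R : realType)
    (P : probability Omega R) (X : {RV P >-> plane R})
    (h k : components R) : Prop :=
  [/\ c0 h = c0 k %[ae distribution P X],
      c1 h = c1 k %[ae distribution P X],
      c2 h = c2 k %[ae distribution P X] &
      c12 h = c12 k %[ae distribution P X]].

Definition hierarchical_decomposition d (Omega : measurableType d)
    (R : realType) (P : probability Omega R) (X : {RV P >-> plane R})
    (eta : plane R -> R) (h : components R) : Prop :=
  in_H0_product X h /\
  eta = (fun x => c0 h x + c1 h x + c2 h x + c12 h x) %[ae distribution P X].

Definition system_S d (Omega : measurableType d) (R : realType)
    (P : probability Omega R) (X : {RV P >-> plane R})
    (eta : plane R -> R) (h : components R) : Prop :=
  [/\ c0 h = proj X (H X sempty) eta %[ae distribution P X],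
      c1 h \+ proj X (H0 X s1) (c2 h) = proj X (H0 X s1) eta
        %[ae distribution P X],
      proj X (H0 X s2) (c1 h) \+ c2 h = proj X (H0 X s2) eta
        %[ae distribution P X] &
      c12 h = proj X (H0 X s12) eta %[ae distribution P X]].

(* Main.v *)
Require Import Defs.
From HB Require Import structures.
From mathcomp Require Import all_boot all_order all_algebra.
From mathcomp Require Import all_classical all_reals all_analysis.
From mathcomp Require Import measurable_realfun.
From mathcomp Require Import ring lra.

(** Write Q for the law of X and Q1, Q2 for its marginals.  Integrating the
density bound for u = {1} against a nonnegative function gives, by Tonelli,
the minorization Q >= M (Q1 x Q2) ([product_law_le]).  Let a belong to H_1^0
and b to H_2^0.  Under Q1 x Q2 the coordinates are independent and a, b are
centred, so the cross term of (a + b)^2 integrates to 0 and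
<<
   M (|a|^2 + |b|^2) <= |a + b|^2        ([sum_nrm2_ge])
>>
in L^2(Q).  This inequality carries the whole argument.

It gives existence.  Each H_u^0 is closed in L^2(Q) ([H0_closed]), and by the
inequality a Cauchy sequence of sums a_n + b_n splits into two Cauchy
sequences, so that H_1^0 + H_2^0 is closed too ([main_effects_closed]).  Take
eta_0 to be the projection of eta on the constants and eta_1 + eta_2 its
projection on H_1^0 + H_2^0; the remainder is then orthogonal to the constants,
to H_1^0 and to H_2^0, that is, it lies in H_12^0 ([decomposition_exists]).

It also gives uniqueness.  If two solutions of the linear system differ by d1
and d2 in their middle components, the two middle equations say that d1 + d2 is
orthogonal to both H_1^0 and H_2^0, hence to itself, so that d1 = d2 = 0 by the
inequality ([system_unique]).  Pairing a decomposition of eta with elements of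
the H_u^0 shows that it solves the system ([decomposition_solves]), so the
decomposition is unique because the solution is.

Functions are kept as such rather than taken modulo a.s. equality, because
membership in H_u is a pointwise condition.  Limits in L^2 must therefore be
chosen by a rule that depends only on the values of the sequence at the given
point; [L2_limit] does this.  Completeness is only needed along sequences with
a geometric rate ([rapid]), and minimizing sequences can be chosen with such a
rate, which removes any extraction of subsequences. *)

Set Implicit Arguments.
Unset Strict Implicit.
Unset Printing Implicit Defensive.

Import Order.TTheory GRing.Theory Num.Theory.
Import numFieldNormedType.Exports.

Local Open Scope classical_set_scope.
Local Open Scope charge_scope.
Local Open Scope ring_scope.

(** * The semi-inner product of L^2 *)

(** The discriminant of a nonnegative quadratic trinomial.  It serves twice:
for the Cauchy-Schwarz inequality, and to see that an element that almost
minimizes the distance to a subspace has a residual almost orthogonal to it. *)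
Lemma quadratic_discr (R : realFieldType) (a b c : R) : 0 <= c ->
  (forall t, 0 <= a - 2 * t * b + t ^+ 2 * c) -> b ^+ 2 <= a * c.
Proof.
rewrite le_eqVlt => /orP[/eqP <-|c0] q.
  have [->|b0] := eqVneq b 0; first by rewrite expr0n/= mulr0.
  (* the trinomial is then affine in t, and equal to -1 at this point *)
  have := q ((a + 1) / (2 * b)); have := q 0.
  rewrite !mulr0 mul0r !addr0 subr0 => a0.
  rewrite (_ : 2 * ((a + 1) / (2 * b)) * b = a + 1); last by field.
  lra.
(* b / c is the minimizer *)
have := q (b / c).
rewrite (_ : _ + _ = (a * c - b ^+ 2) / c); last by field; rewrite gt_eqF.
by rewrite pmulr_lge0 ?invr_gt0// subr_ge0.
Qed.

Section L2_form.
Context d (T : measurableType d) (R : realType).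
Variable mu : {finite_measure set T -> \bar R}.
Implicit Types f g h k : T -> R.

Definition L2_ip f g : R := \int[mu]_x (f x * g x).

Local Notation L2 := (Lfun mu 2%:E).
Local Notation nrm2 f := (L2_ip f f).

Lemma L2_measurable f : f \in L2 -> measurable_fun setT f.
Proof. by rewrite inE => /andP[/[!inE]]. Qed.

Lemma L2D f g : f \in L2 -> g \in L2 -> f + g \in L2.
Proof. by move=> Lf Lg; apply: (Lfun_addr_closed mu (lee1n 2)).2. Qed.

Lemma L2Z a f : f \in L2 -> a *: f \in L2.
Proof.
move=> Lf; have [_ /(_ a f 0)] := Lfun_submod_closed mu (lee1n 2).
by rewrite addr0; apply => //; rewrite (Lfun_addr_closed mu (lee1n 2)).1.
Qed.

Lemma L2N f : f \in L2 -> - f \in L2.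
Proof. by move=> Lf; rewrite -scaleN1r L2Z. Qed.

Lemma L2B f g : f \in L2 -> g \in L2 -> f - g \in L2.
Proof. by move=> Lf Lg; rewrite L2D// L2N. Qed.

Lemma L2M_integrable f g : f \in L2 -> g \in L2 ->
  mu.-integrable setT (EFin \o (fun x => f x * g x)).
Proof. by move=> Lf Lg; apply/Lfun1_integrable/Lfun2_mul_Lfun1. Qed.

Lemma L2P f : measurable_fun setT f ->
  (\int[mu]_x (f x * f x)%:E < +oo)%E -> f \in L2.
Proof.
move=> mf fi; rewrite inE; apply/andP; split; rewrite inE//=.
rewrite /finite_norm unlock poweR_lty//; apply: le_lt_trans fi.
apply: ge0_le_integral => //=.
- apply/measurable_EFinP.
  apply/(@measurableT_comp _ _ _ _ _ _ (fun x : R => x `^ 2)%R) => //.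
  exact/measurableT_comp.
- by apply/measurable_EFinP; exact: measurable_funM.
- move=> x _; rewrite lee_fin powR_mulrn// -normrX expr2 ger0_norm//.
  by rewrite -expr2 sqr_ge0.
Qed.

Lemma ipC f g : L2_ip f g = L2_ip g f.
Proof. by apply: eq_Rintegral => x _; rewrite mulrC. Qed.

Lemma ipDl f g h : f \in L2 -> g \in L2 -> h \in L2 ->
  L2_ip (f + g) h = L2_ip f h + L2_ip g h.
Proof.
move=> Lf Lg Lh; rewrite /L2_ip -RintegralD//; [|exact: L2M_integrable..].
by apply: eq_Rintegral => x _; rewrite -mulrDl.
Qed.

Lemma ipZl a f h : f \in L2 -> h \in L2 -> L2_ip (a *: f) h = a * L2_ip f h.
Proof.
move=> Lf Lh; rewrite /L2_ip -RintegralZl//; last exact: L2M_integrable.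
by apply: eq_Rintegral => x _; rewrite mulrA.
Qed.

Lemma ipBl f g h : f \in L2 -> g \in L2 -> h \in L2 ->
  L2_ip (f - g) h = L2_ip f h - L2_ip g h.
Proof. by move=> Lf Lg Lh; rewrite ipDl ?L2N// -scaleN1r ipZl// mulN1r. Qed.

Lemma ipDr f g h : f \in L2 -> g \in L2 -> h \in L2 ->
  L2_ip h (f + g) = L2_ip h f + L2_ip h g.
Proof. by move=> *; rewrite ipC ipDl// ![L2_ip _ h]ipC. Qed.

Lemma ipBr f g h : f \in L2 -> g \in L2 -> h \in L2 ->
  L2_ip h (f - g) = L2_ip h f - L2_ip h g.
Proof. by move=> *; rewrite ipC ipBl// ![L2_ip _ h]ipC. Qed.

Lemma ipZr a f h : f \in L2 -> h \in L2 -> L2_ip h (a *: f) = a * L2_ip h f.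
Proof. by move=> *; rewrite ipC ipZl// ipC. Qed.

Lemma nrm2_ge0 f : 0 <= nrm2 f.
Proof. by apply: Rintegral_ge0 => x _; rewrite -expr2 sqr_ge0. Qed.

Lemma nrm2_integral f : f \in L2 -> (\int[mu]_x (f x * f x)%:E)%E = (nrm2 f)%:E.
Proof.
move=> Lf; rewrite fineK//; apply: integrable_fin_num => //.
exact: L2M_integrable.
Qed.

Lemma ae_eq_ip f g h : f \in L2 -> g \in L2 -> h \in L2 ->
  f = g %[ae mu] -> L2_ip f h = L2_ip g h.
Proof.
move=> Lf Lg Lh fg; congr fine; apply: ae_eq_integral => //.
- exact: measurable_int (L2M_integrable Lf Lh).
- exact: measurable_int (L2M_integrable Lg Lh).
- by apply: filterS fg => x /(_ I) fgx _; rewrite fgx.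
Qed.

Lemma nrm2_eq0 f : f \in L2 -> nrm2 f = 0 -> f = 0 %[ae mu].
Proof.
move=> Lf f0; have mff := measurable_int _ (L2M_integrable Lf Lf).
have /(ae_eq_integral_abs mu measurableT mff) :
    (\int[mu]_x `|(f x * f x)%:E| = 0)%E.
  under eq_integral do rewrite gee0_abs ?lee_fin -?expr2 ?sqr_ge0//.
  by rewrite nrm2_integral// f0.
apply: filterS => x /(_ I) /= /eqP; rewrite eqe mulf_eq0 orbb.
by move=> /eqP.
Qed.

Lemma nrm2_eq0P f g : f \in L2 -> g \in L2 ->
  nrm2 (f - g) = 0 -> f = g %[ae mu].
Proof.
move=> Lf Lg /(nrm2_eq0 (L2B Lf Lg)); apply: filterS => x /(_ I) fg _.
by apply/eqP; rewrite -subr_eq0; apply/eqP.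
Qed.

Lemma nrm2Z a f : f \in L2 -> nrm2 (a *: f) = a ^+ 2 * nrm2 f.
Proof. by move=> Lf; rewrite ipZl ?L2Z// ipZr// mulrA expr2. Qed.

Lemma nrm2D f g : f \in L2 -> g \in L2 ->
  nrm2 (f + g) = nrm2 f + 2 * L2_ip f g + nrm2 g.
Proof.
move=> Lf Lg; rewrite ipDl ?L2D// !ipDr// (ipC g f); ring.
Qed.

Lemma nrm2B f g : f \in L2 -> g \in L2 ->
  nrm2 (f - g) = nrm2 f - 2 * L2_ip f g + nrm2 g.
Proof.
move=> Lf Lg; rewrite ipBl ?L2B// !ipBr// (ipC g f); ring.
Qed.

Lemma nrm2D_le f g : f \in L2 -> g \in L2 ->
  nrm2 (f + g) <= 2 * (nrm2 f + nrm2 g).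
Proof.
by move=> Lf Lg; have := nrm2_ge0 (f - g); rewrite nrm2B// nrm2D//; lra.
Qed.

Lemma ip_cauchy_schwarz f g : f \in L2 -> g \in L2 ->
  L2_ip f g ^+ 2 <= nrm2 f * nrm2 g.
Proof.
move=> Lf Lg; apply: quadratic_discr => [|t]; first exact: nrm2_ge0.
have := nrm2_ge0 (f - t *: g).
by rewrite nrm2B ?L2Z// nrm2Z// ipZr// mulrA.
Qed.

End L2_form.

(** * Completeness of L^2 along geometric Cauchy sequences *)

Section Riesz_Fischer.
Context d (T : measurableType d) (R : realType).
Variable mu : {finite_measure set T -> \bar R}.
Implicit Types (f : T -> R) (g : (T -> R)^nat).

Local Notation L2 := (Lfun mu 2%:E).
Local Notation nrm2 f := (L2_ip mu f f).

Definition rapid (C : R) (g : (T -> R)^nat) :=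
  forall m n, (n <= m)%N -> nrm2 (g m - g n) <= C / 4 ^+ n.

(** The value at x depends on the sequence (g n x) only, so that any invariance
shared by all the g n passes to the limit; [limn_esup], unlike a limit, is
measurable without any convergence. *)
Definition L2_limit (g : (T -> R)^nat) : T -> R :=
  fun x => fine (limn_esup (fun n => (g n x)%:E)).

Lemma rapid_ge0 C g : rapid C g -> 0 <= C.
Proof.
move=> /(_ 0%N 0%N (leqnn _)); rewrite expr0 divr1; apply: le_trans.
exact: nrm2_ge0.
Qed.

Lemma L2_limitE g x : cvgn (g ^~ x) -> g n x @[n --> \oo] --> L2_limit g x.
Proof.
move=> gx; rewrite /L2_limit.
have glim : (g n x)%:E @[n --> \oo] --> (limn (g ^~ x))%:E.
  by apply: cvg_EFin; [exact: nearW|exact: gx].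
by rewrite (cvg_limn_einf_sup glim).2/=.
Qed.

Lemma measurable_L2_limit g : (forall n, measurable_fun setT (g n)) ->
  measurable_fun setT (L2_limit g).
Proof.
move=> mg; apply: measurableT_comp => //.
by apply: measurable_fun_limn_esup => n; exact/measurable_EFinP.
Qed.

Lemma limn_einf_le (u : (\bar R)^nat) c : (forall n, (u n <= c)%E) ->
  (limn_einf u <= c)%E.
Proof.
move=> uc; rewrite limn_einf_lim; apply: lime_le; first exact: is_cvg_einfs.
apply: nearW => n; apply: le_trans (uc n).
by apply: ereal_inf_lbound; exists n => /=.
Qed.

Let mass : R := fine (mu setT).

(** A substitute for the Hoelder inequality, from |t| <= s t^2 + 1 / s; the
parameter s is to be balanced against the size of the L^2 norm. *)
Lemma integral_norm_le f (s : R) : f \in L2 -> 0 < s ->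
  (\int[mu]_x `|f x|%:E <= (s * nrm2 f + s^-1 * mass)%:E)%E.
Proof.
move=> Lf s0; have mf := L2_measurable Lf.
have -> : ((s * nrm2 f + s^-1 * mass)%:E =
    \int[mu]_x ((s * (f x * f x))%:E + (s^-1)%:E))%E.
  rewrite ge0_integralD//=; last 3 first.
  - by move=> x _; rewrite lee_fin mulr_ge0// ?(ltW s0)// -expr2 sqr_ge0.
  - apply/measurable_EFinP; apply: measurable_funM => //.
    exact: measurable_funM.
  - by move=> x _; rewrite lee_fin invr_ge0 ltW.
  under eq_integral do rewrite EFinM.
  rewrite ge0_integralZl ?lee_fin ?(ltW s0)//; last 2 first.
  - by apply/measurable_EFinP; exact: measurable_funM.
  - by move=> x _; rewrite lee_fin -expr2 sqr_ge0.
  have massE : mu setT = mass%:E by rewrite fineK ?fin_num_measure.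
  by rewrite nrm2_integral// integral_cst//= massE.
apply: ge0_le_integral => //=.
- by apply/measurable_EFinP; exact: measurableT_comp.
- apply/measurable_EFinP; apply: measurable_funD => //.
  by apply: measurable_funM => //; exact: measurable_funM.
- move=> x _; rewrite -EFinD lee_fin -expr2 -real_normK ?num_real//.
  set t := `|f x|.
  rewrite -subr_ge0 (_ : _ - _ = s * (t - (2 * s)^-1) ^+ 2 + 3 / 4 * s^-1).
    by rewrite addr_ge0// mulr_ge0 ?sqr_ge0 ?invr_ge0// ltW.
  by field; rewrite gt_eqF.
Qed.

(** The increments have integrals summing to a finite value, so that almost
everywhere the telescoping series of increments converges absolutely. *)
Lemma rapid_cvg_ae C g : (forall n, g n \in L2) -> rapid C g ->
  {ae mu, forall x, cvgn (g ^~ x)}.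
Proof.
move=> Lg rg; have C0 := rapid_ge0 rg.
have mg n : measurable_fun setT (g n) by apply: L2_measurable (Lg n).
pose D n x : R := `|g n.+1 x - g n x|.
have mD n : measurable_fun setT (EFin \o D n).
  apply/measurable_EFinP; apply: measurableT_comp => //.
  exact: measurable_funB.
have D0 n x : (0 <= (D n x)%:E)%E by rewrite lee_fin /D.
have intD n : (\int[mu]_x (D n x)%:E <= ((C + mass) / 2 ^+ n)%:E)%E.
  (* s = 2^n balances the squared norm, at most C / 4^n, with 1 / s *)
  have s0 : 0 < (2 : R) ^+ n by rewrite exprn_gt0.
  apply: le_trans (integral_norm_le (L2B (Lg n.+1) (Lg n)) s0) _.
  rewrite lee_fin mulrDl [X in _ + X]mulrC lerD2r.
  apply: le_trans (ler_wpM2l (ltW s0) (rg n.+1 n (leqnSn n))) _.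
  rewrite (_ : 4 = 2 * 2); last by ring.
  rewrite exprMn le_eqVlt; apply/orP; left; apply/eqP.
  by field; rewrite expf_neq0.
have S_int : mu.-integrable setT (fun x => (\sum_(n <oo) (D n x)%:E)%E).
  apply/integrableP; split.
    apply: (ge0_emeasurable_sum (h := fun n x => (D n x)%:E) (P := xpredT)).
      by move=> n x _ _; exact: D0.
    by move=> n _; exact: mD.
  under eq_integral do rewrite gee0_abs ?nneseries_ge0//.
  rewrite integral_nneseries//.
  apply: (@le_lt_trans _ _ (2 * (C + mass))%:E); last by rewrite ltry.
  apply: lime_le.
    by apply: is_cvg_nneseries => n _ _; apply: integral_ge0 => x _; exact: D0.
  apply: nearW => n.
  apply: (@le_trans _ _ (2 * (C + mass) - 2 * (C + mass) / 2 ^+ n)%:E).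
    elim: n => [|n IH].
      by rewrite big_nil expr0 divr1 subrr.
    rewrite big_nat_recr//=; apply: le_trans (leeD IH (intD n)) _.
    rewrite -EFinD lee_fin exprS le_eqVlt; apply/orP; left; apply/eqP.
    by field; rewrite expf_neq0.
  rewrite lee_fin lerBlDr lerDl divr_ge0 ?exprn_ge0// mulr_ge0// addr_ge0//.
  by rewrite /mass fine_ge0.
have := integrable_ae measurableT S_int; apply: filterS => x /(_ I) Sfin.
have : cvgn (series (fun n => g n.+1 x - g n x)).
  apply: normed_cvg; apply: nondecreasing_is_cvgn.
    move=> m n mn /=.
    apply: (@nondecreasing_series _ (D ^~ x) xpredT 0%N) => // k _ _.
    by rewrite /D.
  exists (fine (\sum_(n <oo) (D n x)%:E)%E) => _ [n _ <-].
  rewrite /= -lee_fin fineK//; apply: le_trans (nneseries_lim_ge n _) => //.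
  by rewrite -sumEFin.
move=> cs.
have -> : g ^~ x = (fun n => g 0%N x + series (telescope (g ^~ x)) n).
  by apply/funext => n; rewrite -eq_sum_telescope.
by apply: is_cvgD => //; exact: is_cvg_cst.
Qed.

(** Riesz-Fischer: by Fatou's lemma the limit inherits, rate included, the
bounds satisfied by the differences of the terms. *)
Theorem L2_rapid_complete C g : (forall n, g n \in L2) -> rapid C g ->
  L2_limit g \in L2 /\ forall n, nrm2 (L2_limit g - g n) <= C / 4 ^+ n.
Proof.
move=> Lg rg; set f := L2_limit g.
have mg n : measurable_fun setT (g n) by apply: L2_measurable (Lg n).
have mf : measurable_fun setT f by exact: measurable_L2_limit.
have bound n : (\int[mu]_x ((f - g n) x * (f - g n) x)%:E <= (C / 4 ^+ n)%:E)%E.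
  pose u m x := ((g (n + m)%N x - g n x) * (g (n + m)%N x - g n x))%:E.
  have mu_ m : measurable_fun setT (u m).
    by apply/measurable_EFinP; apply: measurable_funM; exact: measurable_funB.
  have u0 m x : (0 <= u m x)%E by rewrite lee_fin -expr2 sqr_ge0.
  have uC m : (\int[mu]_x u m x <= (C / 4 ^+ n)%:E)%E.
    rewrite (nrm2_integral (L2B (Lg (n + m)%N) (Lg n))) lee_fin.
    by apply: rg; exact: leq_addr.
  apply: le_trans (limn_einf_le uC).
  apply: le_trans (fatou _ measurableT mu_ _) => //.
  rewrite le_eqVlt; apply/orP; left; apply/eqP; apply: ae_eq_integral => //.
  - apply/measurable_EFinP; apply: measurable_funM; exact: measurable_funB.
  - apply: measurableT_comp => //; apply: measurable_fun_limn_esup => m.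
    exact: measurableT_comp.
  have := rapid_cvg_ae Lg rg; apply: filterS => x gx _.
  apply/esym; apply: (cvg_limn_einf_sup _).1.
  apply: cvg_EFin; first exact: nearW.
  have gf : g (n + m)%N x @[m --> \oo] --> f x.
    under eq_cvg do rewrite addnC.
    by have := L2_limitE gx; rewrite -(cvg_shiftn n).
  by apply: cvgM; apply: cvgB => //; exact: cvg_cst.
have LB n : f - g n \in L2.
  apply: L2P; first exact: measurable_funB.
  by apply: le_lt_trans (bound n) _; rewrite ltry.
split; first by rewrite -(subrK (g 0%N) f) L2D.
by move=> n; rewrite -lee_fin -nrm2_integral.
Qed.

End Riesz_Fischer.

(** * Orthogonal projection onto closed subspaces *)

Section L2_projection.
Context d (T : measurableType d) (R : realType).
Variable mu : {finite_measure set T -> \bar R}.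
Implicit Types (f k : T -> R) (g : (T -> R)^nat) (K : set (T -> R)).

Local Notation L2 := (Lfun mu 2%:E).
Local Notation ip := (L2_ip mu).
Local Notation nrm2 f := (ip f f).

Definition L2_subspace K :=
  [/\ forall f, K f -> f \in L2, K 0 &
      forall a f h, K f -> K h -> K ((a *: f : T -> R) + h)].

(** Closedness, tested on the geometric Cauchy sequences only; the constant of
the rate may change in the limit. *)
Definition L2_closed K := forall C g, (forall n, K (g n)) -> rapid mu C g ->
  exists2 f, K f & exists C', forall n, nrm2 (f - g n) <= C' / 4 ^+ n.

Lemma subspaceD K f h : L2_subspace K -> K f -> K h -> K (f + h).
Proof. by move=> [_ _ Klin] Kf Kh; rewrite -[f]scale1r; exact: Klin. Qed.

Lemma subspaceZ K a f : L2_subspace K -> K f -> K (a *: f).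
Proof. by move=> [_ K0 Klin] Kf; rewrite -[_ *: _]addr0; exact: Klin. Qed.

Lemma subspaceB K f h : L2_subspace K -> K f -> K h -> K (f - h).
Proof.
by move=> Ks Kf Kh; rewrite -scaleN1r addrC; have [_ _] := Ks; apply.
Qed.

Lemma le0_geometric (a C : R) : (forall n, a <= C / 4 ^+ n) -> a <= 0.
Proof.
move=> aC; rewrite leNgt; apply/negP => a0.
have := aC (Num.truncn (C / a)).+1; rewrite ler_pdivlMr ?exprn_gt0//.
rewrite mulrC -ler_pdivlMr//; apply/negP; rewrite -ltNge.
apply: lt_trans (truncnS_gt (C / a)) _.
by rewrite -natrX ltr_nat ltn_expl.
Qed.

(** Elements g n of K whose squared distance to f is within 4^-n of the infimum
delta form a geometric Cauchy sequence, by the parallelogram identity.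
The residual f - g n is orthogonal to K up to an error of order 2^-n, because
g n almost minimizes the distance; orthogonality is thus obtained in the limit
without checking that the infimum is attained. *)
Theorem L2_projection_exists K f : L2_subspace K -> L2_closed K -> f \in L2 ->
  exists2 g, K g & forall k, K k -> ip (f - g) k = 0.
Proof.
move=> Ks Kc Lf; have [KL K0 Klin] := Ks.
pose D := [set nrm2 (f - k) | k in K].
have infD : has_inf D.
  by split; [exists (nrm2 (f - 0)), 0|exists 0 => _ [k _ <-]; exact: nrm2_ge0].
pose delta := inf D.
have deltaP k : K k -> delta <= nrm2 (f - k).
  by move=> Kk; apply: ge_inf; [exact: infD.2|exists k].
have /choice[g gP] n : exists k, K k /\ nrm2 (f - k) < delta + (4 ^+ n)^-1.
  have [|_ [k Kk <-] fk] := inf_adherent (eps := (4 ^+ n)^-1) _ infD.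
    by rewrite invr_gt0 exprn_gt0.
  by exists k.
have Kg n : K (g n) by have [] := gP n.
have Lg n : g n \in L2 by exact: KL.
have LB n : f - g n \in L2 by exact: L2B.
have g_rapid : rapid mu 4 g.
  move=> m n nm.
  pose b : T -> R := (f - g m) + (f - g n).
  have := deltaP _ (subspaceZ 2^-1 Ks (subspaceD Ks (Kg m) (Kg n))).
  have -> : f - (2^-1 *: (g m + g n) : T -> R) = 2^-1 *: b.
    apply/funext => x.
    change (f x - 2^-1 * (g m x + g n x) =
      2^-1 * ((f x - g m x) + (f x - g n x))).
    by field.
  have -> : g m - g n = (f - g n) - (f - g m).
    by rewrite opprB [RHS]addrC addrA subrK.
  have Lb : b \in L2 by exact: L2D.
  rewrite nrm2Z// /b (nrm2D (LB m) (LB n)) (nrm2B (LB n) (LB m)).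
  rewrite (ipC mu (f - g n) (f - g m)).
  have [_ gm] := gP m; have [_ gn] := gP n.
  have : (4 ^+ m)^-1 <= (4 ^+ n)^-1 :> R.
    by rewrite lef_pV2 ?posrE ?exprn_gt0// ler_eXn2l// ltr1n.
  lra.
have [h Kh [C' hC]] := Kc _ _ Kg g_rapid.
have Lh := KL _ Kh.
exists h => // k Kk; have Lk := KL _ Kk.
have near n : ip (f - g n) k ^+ 2 <= (4 ^+ n)^-1 * nrm2 k.
  apply: le_trans (ler_wpM2r (nrm2_ge0 mu k) (_ : nrm2 (f - g n) - delta <= _)).
    apply: quadratic_discr => [|t]; first exact: nrm2_ge0.
    have := deltaP _ (Klin t _ _ Kk (Kg n)).
    have -> : f - ((t *: k : T -> R) + g n) = f - g n - (t *: k : T -> R).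
      by rewrite opprD addrCA [LHS]addrC.
    rewrite (nrm2B (LB n) (L2Z t Lk)) nrm2Z// ipZr//; lra.
  by rewrite lerBlDl; have [_ /ltW] := gP n.
have far n : ip (h - g n) k ^+ 2 <= C' / 4 ^+ n * nrm2 k.
  apply: le_trans (ip_cauchy_schwarz (L2B Lh (Lg n)) Lk) _.
  by apply: ler_wpM2r; [exact: nrm2_ge0|exact: hC].
apply/eqP; rewrite -sqrf_eq0 eq_le sqr_ge0 andbT.
apply: (le0_geometric (C := 2 * (1 + C') * nrm2 k)) => n.
have -> : f - h = (f - g n) - (h - g n) by rewrite opprB addrA subrK.
rewrite ipBl ?L2B//.
have -> : 2 * (1 + C') * nrm2 k / 4 ^+ n =
    2 * ((4 ^+ n)^-1 * nrm2 k) + 2 * (C' / 4 ^+ n * nrm2 k) by ring.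
have := near n; have := far n.
set x := ip (f - g n) k; set y := ip (h - g n) k.
have := sqr_ge0 (x + y); rewrite sqrrB sqrrD. lra.
Qed.

End L2_projection.

(** * Subsets of the two indices *)

Lemma s1_proper : s1 \proper s12.
Proof.
by apply/properP; split; [exact: finset.subsetT|exists ord_max; rewrite !inE].
Qed.

Lemma s2_proper : s2 \proper s12.
Proof.
by apply/properP; split; [exact: finset.subsetT|exists ord0; rewrite !inE].
Qed.

Lemma sempty_proper1 : sempty \proper s1.
Proof. by rewrite finset.proper0; apply/set0Pn; exists ord0; rewrite inE. Qed.
Lemma sempty_proper2 : sempty \proper s2.
Proof.
by rewrite finset.proper0; apply/set0Pn; exists ord_max; rewrite inE.
Qed.

Lemma sempty_proper12 : sempty \proper s12.
Proof. by rewrite finset.proper0; apply/set0Pn; exists ord0; rewrite inE. Qed.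

Lemma ord2E (l : 'I_2) : l = ord0 \/ l = ord_max.
Proof. by case: l => [[|[|//]] l2]; [left|right]; apply/val_inj. Qed.

Lemma proper12 (v : {set 'I_2}) :
  v \proper s12 -> [\/ v = sempty, v = s1 | v = s2].
Proof.
move=> /properP[_ [l _ lv]].
have ordE (w : {set 'I_2}) : (ord0 \in v) = (ord0 \in w) ->
    (ord_max \in v) = (ord_max \in w) -> v = w.
  by move=> w0 w1; apply/setP => j; have [->|->] := ord2E j.
case e0 : (ord0 \in v); case e1 : (ord_max \in v).
- by move: lv; have [->|->] := ord2E l; rewrite ?e0 ?e1.
- by apply: Or32; apply: ordE; rewrite ?e0 ?e1 inE.
- by apply: Or33; apply: ordE; rewrite ?e0 ?e1 inE.
- by apply: Or31; apply: ordE; rewrite ?e0 ?e1 inE.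
Qed.

(** * Image laws *)

Section distribution_transfer.
Context d d' (T : measurableType d) (T' : measurableType d') (R : realType).
Variables (P : probability T R) (X : {mfun T >-> T'}).
Implicit Types f g : T' -> R.

Lemma integral_distributionE (f : T' -> \bar R) : measurable_fun setT f ->
  (\int[distribution P X]_y f y = \int[P]_x (f \o X) x)%E.
Proof.
move=> mf; rewrite [LHS]integralE [RHS]integralE; congr (_ - _)%E.
- rewrite (@ge0_integral_distribution _ _ _ _ _ _ X)//; last first.
    exact: measurable_funepos.
  by rewrite (funepos_comp f X).
- rewrite (@ge0_integral_distribution _ _ _ _ _ _ X)//; last first.
    exact: measurable_funeneg.
  by rewrite (funeneg_comp f X).
Qed.

Lemma ip_distribution f g : measurable_fun setT f -> measurable_fun setT g ->
  L2_ip (distribution P X) f g = L2_ip P (f \o X) (g \o X).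
Proof.
move=> mf mg; rewrite /L2_ip /Rintegral integral_distributionE//.
by apply/measurable_EFinP; exact: measurable_funM.
Qed.

Lemma L2_distribution f : measurable_fun setT f ->
  f \o X \in Lfun P 2%:E -> f \in Lfun (distribution P X) 2%:E.
Proof.
move=> mf Lf; apply: L2P => //.
rewrite integral_distributionE; last first.
  by apply/measurable_EFinP; exact: measurable_funM.
by rewrite (nrm2_integral Lf) ltry.
Qed.

End distribution_transfer.

(** * The joint law dominates a multiple of the product of its marginals *)

Section joint_law.
Context (R : realType) d (Omega : measurableType d) (P : probability Omega R).
Variable X : {RV P >-> plane R}.

Local Notation Q := (distribution P X).
Local Notation L2 := (Lfun Q 2%:E).
Local Notation Q1 := (distribution Q (@coord1 R)).
Local Notation Q2 := (distribution Q (@coord2 R)).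

Lemma innerE h k : measurable_fun setT h -> measurable_fun setT k ->
  inner X h k = L2_ip Q h k.
Proof. by move=> mh mk; rewrite ip_distribution// /inner unlock. Qed.

Section minorization.
Variables nu1 nu2 : {sigma_finite_measure set (measurableTypeR R) -> \bar R}.
Hypothesis PX_nu : Q `<< nu_prod nu1 nu2.

(** This holds even if the other reference measure is infinite, since
0 * oo = 0. *)
Lemma null_cylinder1 A : measurable A -> nu1 A = 0%E ->
  nu_prod nu1 nu2 (@coord1 R @^-1` A) = 0%E.
Proof.
move=> mA A0; have -> : @coord1 R @^-1` A = A `*` setT.
  by apply/seteqP; split=> [x|x []].
rewrite /nu_prod product_measure1E//.
by rewrite [X in (X * _)%E](_ : _ = 0%E) ?mul0e//; exact: A0.
Qed.

Lemma null_cylinder2 A : measurable A -> nu2 A = 0%E ->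
  nu_prod nu1 nu2 (@coord2 R @^-1` A) = 0%E.
Proof.
move=> mA A0; have -> : @coord2 R @^-1` A = setT `*` A.
  by apply/seteqP; split=> [x|x []].
rewrite /nu_prod product_measure1E//.
by rewrite [X in (_ * X)%E](_ : _ = 0%E) ?mule0//; exact: A0.
Qed.

Lemma marginal_dominated1 : Q1 `<< nu1.
Proof.
apply/null_content_dominatesP => A mA A0.
move/null_content_dominatesP : PX_nu; apply; last exact: null_cylinder1.
by rewrite -[_ @^-1` _]setTI; exact: measurable_funPT.
Qed.

Lemma marginal_dominated2 : Q2 `<< nu2.
Proof.
apply/null_content_dominatesP => A mA A0.
move/null_content_dominatesP : PX_nu; apply; last exact: null_cylinder2.
by rewrite -[_ @^-1` _]setTI; exact: measurable_funPT.
Qed.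

Lemma ae_coord1 (E : measurableTypeR R -> Prop) : {ae nu1, forall t, E t} ->
  {ae nu_prod nu1 nu2, forall x, E x.1}.
Proof.
move=> [N [mN N0 EN]]; exists (@coord1 R @^-1` N); split.
- by rewrite -[_ @^-1` _]setTI; exact: measurable_funPT.
- exact: null_cylinder1.
- by move=> x; exact: EN.
Qed.

Lemma ae_coord2 (E : measurableTypeR R -> Prop) : {ae nu2, forall t, E t} ->
  {ae nu_prod nu1 nu2, forall x, E x.2}.
Proof.
move=> [N [mN N0 EN]]; exists (@coord2 R @^-1` N); split.
- by rewrite -[_ @^-1` _]setTI; exact: measurable_funPT.
- exact: null_cylinder2.
- by move=> x; exact: EN.
Qed.

Variable M : R.
Hypothesis M_gt0 : 0 < M.
Hypothesis pX_ge : \forall x \ae (nu_prod nu1 nu2),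
  (M%:E * (('d (charge_of_finite_measure Q1) '/d nu1) x.1 *
           ('d (charge_of_finite_measure Q2) '/d nu2) x.2)
   <= ('d (charge_of_finite_measure Q) '/d (nu_prod nu1 nu2)) x)%E.

(** The minorization Q >= M (Q1 x Q2).  The three Radon-Nikodym derivatives are
replaced by their everywhere nonnegative versions, which agree with them almost
everywhere; Tonelli's theorem then applies to F p1 p2, and the bound on the
densities compares it with F p. *)
Lemma product_law_le (F : plane R -> \bar R) :
  measurable_fun setT F -> (forall x, 0 <= F x)%E ->
  (M%:E * \int[Q1]_x \int[Q2]_y F (x, y) <= \int[Q]_z F z)%E.
Proof.
move=> mF F0.
have dom1 := marginal_dominated1; have dom2 := marginal_dominated2.
pose p := Radon_Nikodym_SigmaFinite.f Q (nu_prod nu1 nu2).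
pose p1 := Radon_Nikodym_SigmaFinite.f Q1 nu1.
pose p2 := Radon_Nikodym_SigmaFinite.f Q2 nu2.
have p_ge0 x : (0 <= p x)%E by exact: Radon_Nikodym_SigmaFinite.f_ge0.
have p1_ge0 x : (0 <= p1 x)%E by exact: Radon_Nikodym_SigmaFinite.f_ge0.
have p2_ge0 x : (0 <= p2 x)%E by exact: Radon_Nikodym_SigmaFinite.f_ge0.
have mp : measurable_fun setT p.
  exact: measurable_int (Radon_Nikodym_SigmaFinite.f_integrable PX_nu).
have mp1 : measurable_fun setT p1.
  exact: measurable_int (Radon_Nikodym_SigmaFinite.f_integrable dom1).
have mp2 : measurable_fun setT p2.
  exact: measurable_int (Radon_Nikodym_SigmaFinite.f_integrable dom2).
have mp1' : measurable_fun setT (fun x : plane R => p1 x.1).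
  exact: (measurableT_comp mp1 measurable_fst).
have mp2' : measurable_fun setT (fun x : plane R => p2 x.2).
  exact: (measurableT_comp mp2 measurable_snd).
pose G (x : plane R) : \bar R := (F x * (p1 x.1 * p2 x.2))%E.
have mG : measurable_fun setT G.
  by apply: emeasurable_funM => //; exact: emeasurable_funM.
have G0 x : (0 <= G x)%E by rewrite mule_ge0// mule_ge0.
have -> : (\int[Q1]_x \int[Q2]_y F (x, y) = \int[nu_prod nu1 nu2]_z G z)%E.
  rewrite [RHS](fubini_tonelli1 G)//.
  rewrite -(Radon_Nikodym_SigmaFinite.change_of_variables dom1)//; last 2 first.
  - by move=> x; exact: integral_ge0.
  - exact: (measurable_fun_fubini_tonelli_F (m2 := Q2)).
  apply: eq_integral => x _; rewrite /fubini_F /G/=.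
  have mFx : measurable_fun setT (fun y => F (x, y)).
    exact: (measurableT_comp mF (measurable_pair1 x)).
  rewrite -(Radon_Nikodym_SigmaFinite.change_of_variables dom2)//.
  rewrite muleC -ge0_integralZl//; last 2 first.
  - by apply: emeasurable_funM.
  - by move=> y _; rewrite mule_ge0.
  by apply: eq_integral => y _; rewrite muleCA.
rewrite -(Radon_Nikodym_SigmaFinite.change_of_variables PX_nu)// -/p.
rewrite -ge0_integralZl ?lee_fin ?(ltW M_gt0)//.
apply: ae_ge0_le_integral => //.
- by move=> x _; rewrite mule_ge0// lee_fin ltW.
- by apply: emeasurable_funM.
- by move=> x _; rewrite mule_ge0.
- by apply: emeasurable_funM.
have e := ae_eq_Radon_Nikodym_SigmaFinite PX_nu measurableT.
have e1 := ae_coord1 (ae_eq_Radon_Nikodym_SigmaFinite dom1 measurableT).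
have e2 := ae_coord2 (ae_eq_Radon_Nikodym_SigmaFinite dom2 measurableT).
apply: filterS2 (filterI pX_ge e) (filterI e1 e2).
move=> x [+ /(_ I) ex] [/(_ I) e1x /(_ I) e2x] _.
rewrite -ex -e1x -e2x => le.
by rewrite /G muleCA; exact: lee_wpmul2l.
Qed.

End minorization.

(** * The spaces of hierarchically orthogonal functions *)

Local Notation ip := (L2_ip Q).
Local Notation nrm2 f := (ip f f).
Implicit Types (f k : plane R -> R) (u v : {set 'I_2}).

Lemma H0_L2 u f : H0 X u f -> f \in L2.
Proof. by rewrite H0E => -[[]]. Qed.

Lemma H0_measurable u f : H0 X u f -> measurable_fun setT f.
Proof. by move=> /H0_L2/L2_measurable. Qed.

Lemma H0_sempty : H0 X sempty = H X sempty.
Proof. by rewrite /H0 cards0. Qed.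

Lemma H0P u f : H0 X u f <-> H X u f /\
  forall v, v \proper u -> forall k, H0 X v k -> ip f k = 0.
Proof.
rewrite H0E; split=> -[Hf fv]; split=> // v vu k vk; have := fv v vu k vk;
  by rewrite innerE//; [exact: L2_measurable Hf.1|exact: H0_measurable vk].
Qed.

Lemma H0_orth u v f k : v \proper u -> H0 X u f -> H0 X v k -> ip f k = 0.
Proof. by move=> vu /H0P[_ fv]; exact: fv. Qed.

Lemma H0_subspace u : L2_subspace Q (H0 X u).
Proof.
split; first by move=> f; exact: H0_L2.
- apply/H0P; split; first by split; [exact: (Lfun_addr_closed Q (lee1n 2)).1|].
  move=> v _ k /H0_L2 Lk; rewrite -(scale0r 0) ipZl ?mul0r//.
  exact: (Lfun_addr_closed Q (lee1n 2)).1.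
- move=> a f h /H0P[[Lf If] fv] /H0P[[Lh Ih] hv]; apply/H0P; split.
    split; first by rewrite L2D// L2Z.
    move=> x y xy; change (a * f x + h x = a * f y + h y).
    by rewrite (If x y xy) (Ih x y xy).
  move=> v vu k vk; have Lk := H0_L2 vk.
  by rewrite (ipDl (L2Z a Lf))// ipZl// (fv v)// (hv v)// mulr0 addr0.
Qed.

(** Closedness has two sources: [L2_limit] keeps the dependence on the
coordinates in u, and orthogonality to a given k passes to the limit by
Cauchy-Schwarz. *)
Lemma H0_closed u : L2_closed Q (H0 X u).
Proof.
move=> C g gu rg; have Lg n : g n \in L2 by exact: H0_L2 (gu n).
have [Lf fg] := L2_rapid_complete Lg rg.
exists (L2_limit g); last by exists C.
apply/H0P; split.
  split=> // x y xy; congr (fine (limn_esup _)).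
  by apply/funext => n; have /H0P[[_ /(_ x y xy) ->]] := gu n.
move=> v vu k vk; have Lk := H0_L2 vk.
apply/eqP; rewrite -sqrf_eq0 eq_le sqr_ge0 andbT.
apply: (le0_geometric (C := C * nrm2 k)) => n.
have -> : ip (L2_limit g) k = ip (L2_limit g - g n) k.
  by rewrite ipBl// (H0_orth vu (gu n) vk) subr0.
apply: le_trans (ip_cauchy_schwarz (L2B Lf (Lg n)) Lk) _.
by rewrite mulrAC ler_wpM2r// nrm2_ge0.
Qed.

(** The projection of a square integrable function is never the default value,
since H_u^0 is a closed subspace. *)
Lemma proj_spec u f : f \in L2 ->
  H0 X u (Defs.proj X (H0 X u) f) /\
  forall k, H0 X u k -> ip (Defs.proj X (H0 X u) f) k = ip f k.
Proof.
move=> Lf; set S := [set g | H0 X u g /\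
  forall k, H0 X u k -> inner X (f \- g) k = 0].
have : S (Defs.proj X (H0 X u) f).
  have [g ug fg] := L2_projection_exists (H0_subspace u) (@H0_closed u) Lf.
  apply: (xgetPex _ (ex_intro _ g _)); split=> // k uk.
  rewrite innerE ?fg//; last exact: H0_measurable uk.
  exact: L2_measurable (L2B Lf (H0_L2 ug)).
move=> [ug fg]; split=> // k uk; have Lg := H0_L2 ug.
have := fg k uk; rewrite innerE; last exact: H0_measurable uk.
  by rewrite (ipBl Lf Lg (H0_L2 uk)) => /eqP; rewrite subr_eq0 => /eqP.
exact: L2_measurable (L2B Lf Lg).
Qed.

Lemma proj_uniq u f g : f \in L2 -> H0 X u g ->
  (forall k, H0 X u k -> ip g k = ip f k) ->
  g = Defs.proj X (H0 X u) f %[ae Q].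
Proof.
move=> Lf ug fg; have [up fp] := proj_spec u Lf.
have Lg := H0_L2 ug; have Lp := H0_L2 up.
apply: nrm2_eq0P => //; rewrite ipBl ?L2B//.
have ugp := subspaceB (H0_subspace u) ug up.
by rewrite fg// fp// subrr.
Qed.

Lemma H_s1E f : H X s1 f -> f = (fun t => f (t, 0)) \o @coord1 R.
Proof.
move=> [_ If]; apply/funext => x; apply: If => l.
by rewrite finset.in_set1 => /eqP ->; rewrite /Defs.coord eqxx.
Qed.

Lemma H_s2E f : H X s2 f -> f = (fun t => f (0, t)) \o @coord2 R.
Proof.
move=> [_ If]; apply/funext => x; apply: If => l.
by rewrite finset.in_set1 => /eqP ->; rewrite /Defs.coord.
Qed.

Lemma H0_cst c : H0 X sempty (cst c).
Proof. by rewrite H0_sempty; split=> //; exact: Lfun_cst. Qed.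

(** * Decomposition and linear system *)

Section ambient.
Variables nu1 nu2 : {sigma_finite_measure set (measurableTypeR R) -> \bar R}.
Hypothesis PX_nu : Q `<< nu_prod nu1 nu2.
Variable M : R.
Hypothesis M_gt0 : 0 < M.
Hypothesis pX_ge : \forall x \ae (nu_prod nu1 nu2),
  (M%:E * (('d (charge_of_finite_measure Q1) '/d nu1) x.1 *
           ('d (charge_of_finite_measure Q2) '/d nu2) x.2)
   <= ('d (charge_of_finite_measure Q) '/d (nu_prod nu1 nu2)) x)%E.

(** Under the product of the marginals the cross term of (a + b)^2 is the
product of the means of a and b, and b has mean 0 because it is orthogonal to
the constants. *)
Lemma sum_nrm2_ge a b : H0 X s1 a -> H0 X s2 b ->
  M * (nrm2 a + nrm2 b) <= nrm2 (a + b).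
Proof.
move=> Ha Hb; have La := H0_L2 Ha; have Lb := H0_L2 Hb.
have aE := H_s1E ((H0P _ _).1 Ha).1; have bE := H_s2E ((H0P _ _).1 Hb).1.
pose a' : measurableTypeR R -> R := fun t => a (t, 0).
pose b' : measurableTypeR R -> R := fun t => b (0, t).
have ma := L2_measurable La; have mb := L2_measurable Lb.
have ma' : measurable_fun setT a'.
  exact: (measurableT_comp ma (measurable_pair2 (0 : measurableTypeR R))).
have mb' : measurable_fun setT b'.
  exact: (measurableT_comp mb (measurable_pair1 (0 : measurableTypeR R))).
have La' : a' \in Lfun Q1 2%:E by apply: L2_distribution => //; rewrite -aE.
have Lb' : b' \in Lfun Q2 2%:E by apply: L2_distribution => //; rewrite -bE.
have na : L2_ip Q1 a' a' = nrm2 a by rewrite ip_distribution// -aE.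
have nb : L2_ip Q2 b' b' = nrm2 b by rewrite ip_distribution// -bE.
have b'0 : L2_ip Q2 b' (cst 1) = 0.
  by rewrite ip_distribution// -bE (H0_orth sempty_proper2 Hb (H0_cst 1)).
have n1 : L2_ip Q2 (cst 1) (cst 1) = 1.
  transitivity (\int[Q2]_x (1 : R)).
    by apply: eq_Rintegral => x _; rewrite /= mulr1.
  by rewrite Rintegral_cst// mul1r/= probability_setT.
have L1 : cst 1 \in Lfun Q2 2%:E by exact: Lfun_cst.
have int2 t : (\int[Q2]_y ((a' t + b' y) * (a' t + b' y))%:E =
    (a' t * a' t)%:E + (nrm2 b)%:E)%E.
  have Lt := L2Z (a' t) L1.
  have := nrm2_integral (L2D Lt Lb').
  rewrite nrm2D// nrm2Z// n1 ipC ipZr// b'0 nb !mulr0 addr0 mulr1 -EFinD => <-.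
  apply: eq_integral => y _.
  by rewrite -[X in _ = (X * X)%:E]/(a' t * 1 + b' y) mulr1.
have mab := L2_measurable (L2D La Lb).
have := @product_law_le _ _ PX_nu M M_gt0 pX_ge
  (fun x => ((a + b) x * (a + b) x)%:E).
rewrite (nrm2_integral (L2D La Lb)).
under eq_integral => t _.
  under eq_integral => y _.
    have -> : (a + b) (t, y) = a' t + b' y.
      congr (_ + _); first exact: (congr1 (@^~ (t, y)) aE).
      exact: (congr1 (@^~ (t, y)) bE).
    over.
  rewrite int2; over.
rewrite ge0_integralD//=; last 3 first.
- by move=> x _; rewrite lee_fin -expr2 sqr_ge0.
- by apply/measurable_EFinP; exact: measurable_funM.
- by move=> x _; rewrite lee_fin nrm2_ge0.
rewrite (nrm2_integral La') na integral_cst//= probability_setT mule1.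
rewrite -EFinD -EFinM lee_fin; apply.
- by apply/measurable_EFinP; exact: measurable_funM.
- by move=> x; rewrite lee_fin -expr2 sqr_ge0.
Qed.

Lemma sum_nrm2_eq0 a b : H0 X s1 a -> H0 X s2 b -> nrm2 (a + b) = 0 ->
  nrm2 a = 0 /\ nrm2 b = 0.
Proof.
move=> Ha Hb ab0; have := sum_nrm2_ge Ha Hb; rewrite ab0 pmulr_rle0// => le0.
by split; apply/eqP; rewrite eq_le nrm2_ge0 andbT; apply: le_trans le0;
  rewrite ?lerDl ?lerDr nrm2_ge0.
Qed.

Definition main_effects : set (plane R -> R) :=
  [set f | exists a b, [/\ H0 X s1 a, H0 X s2 b & f = a + b]].

Lemma main_effects_subspace : L2_subspace Q main_effects.
Proof.
have S1 := H0_subspace s1; have S2 := H0_subspace s2.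
split.
- by move=> _ [a [b [/H0_L2 La /H0_L2 Lb ->]]]; exact: L2D.
- exists 0, 0; rewrite addr0; split=> //; first by have [] := S1.
  by have [] := S2.
- move=> c _ _ [a [b [Ha Hb ->]]] [a' [b' [Ha' Hb' ->]]].
  exists ((c *: a : plane R -> R) + a'), ((c *: b : plane R -> R) + b').
  split; [by have [_ _] := S1; apply|by have [_ _] := S2; apply|].
  by rewrite scalerDr addrACA.
Qed.

(** The two terms of a Cauchy sequence of sums are themselves Cauchy, by
[sum_nrm2_ge]. *)
Lemma main_effects_closed : L2_closed Q main_effects.
Proof.
move=> C g /choice[a /choice[b abP]] rg.
have Ha n : H0 X s1 (a n) by have [] := abP n.
have Hb n : H0 X s2 (b n) by have [] := abP n.
have gE n : g n = a n + b n by have [] := abP n.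
have rab m n : (n <= m)%N ->
    nrm2 (a m - a n) + nrm2 (b m - b n) <= C / M / 4 ^+ n.
  move=> nm; rewrite mulrAC ler_pdivlMr// mulrC.
  apply: le_trans (rg m n nm).
  have -> : g m - g n = (a m - a n) + (b m - b n).
    by rewrite !gE opprD addrACA.
  apply: sum_nrm2_ge.
    exact: subspaceB (H0_subspace s1) (Ha m) (Ha n).
  exact: subspaceB (H0_subspace s2) (Hb m) (Hb n).
have ra : rapid Q (C / M) a.
  move=> m n nm; apply: le_trans (rab m n nm).
  by rewrite lerDl nrm2_ge0.
have rb : rapid Q (C / M) b.
  move=> m n nm; apply: le_trans (rab m n nm).
  by rewrite lerDr nrm2_ge0.
have [al Hal [Ca CaP]] := H0_closed Ha ra.
have [bl Hbl [Cb CbP]] := H0_closed Hb rb.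
exists (al + bl); first by exists al, bl.
exists (2 * (Ca + Cb)) => n.
have -> : al + bl - g n = (al - a n) + (bl - b n).
  by rewrite gE opprD addrACA.
apply: le_trans (nrm2D_le (L2B (H0_L2 Hal) (H0_L2 (Ha n)))
  (L2B (H0_L2 Hbl) (H0_L2 (Hb n)))) _.
by rewrite -mulrA ler_pM2l// mulrDl lerD.
Qed.

Lemma in_H0_productP h : in_H0_product X h ->
  [/\ H0 X sempty (c0 h), H0 X s1 (c1 h), H0 X s2 (c2 h) & H0 X s12 (c12 h)].
Proof. by rewrite /in_H0_product H0_sempty. Qed.

(** The remainder r is orthogonal to the constants because a and b are, and to
H_1^0 and H_2^0 because these are orthogonal to the constant component e. *)
Lemma decomposition_exists eta : eta \in L2 ->
  exists hs, hierarchical_decomposition X eta hs.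
Proof.
move=> Leta; have [He eP] := proj_spec sempty Leta.
set e := Defs.proj X _ eta in He eP; have Le := H0_L2 He.
have [_ [a [b [Ha Hb ->]]] abP] := L2_projection_exists
  main_effects_subspace main_effects_closed Leta.
have La := H0_L2 Ha; have Lb := H0_L2 Hb; have Lab := L2D La Lb.
pose r := eta - e - (a + b); have Lr : r \in L2 by rewrite !L2B.
exists (Components e a b r); split; last first.
  apply: nearW => x _ /=.
  change (eta x = e x + a x + b x + (eta x - e x - (a x + b x))); ring.
rewrite /in_H0_product -H0_sempty; split=> //=.
apply/H0P; split.
  split=> // x y xy; congr r; have := xy ord0; have := xy ord_max.
  rewrite /Defs.coord /= !finset.in_setT => /(_ isT) x2 /(_ isT) x1.
  by rewrite (surjective_pairing x) x1 x2 -surjective_pairing.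
have rE k : k \in L2 -> ip r k = ip (eta - (a + b)) k - ip e k.
  by move=> Lk; rewrite /r addrAC ipBl ?L2B.
move=> v /proper12[] -> k Hk; have Lk := H0_L2 Hk; rewrite rE//.
- rewrite ipBl// ipDl// (H0_orth sempty_proper1 Ha Hk).
  by rewrite (H0_orth sempty_proper2 Hb Hk) addr0 subr0 eP// subrr.
- rewrite (ipC _ e) (H0_orth sempty_proper1 Hk He) abP ?subrr//.
  by exists k, 0; rewrite addr0; split=> //; have [] := H0_subspace s2.
- rewrite (ipC _ e) (H0_orth sempty_proper2 Hk He) abP ?subrr//.
  by exists 0, k; rewrite add0r; split=> //; have [] := H0_subspace s1.
Qed.

(** In each row, both sides have the same inner products with the elements k of
the space projected onto: all the components of eta vanish against k except
those that the row retains.  In the second row these are c1 and c2, since H_1^0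
and H_2^0 need not be orthogonal. *)
Lemma decomposition_solves eta h : eta \in L2 ->
  hierarchical_decomposition X eta h -> system_S X eta h.
Proof.
move=> Leta [/in_H0_productP[H0h H1h H2h H12h] etaE].
have L0 := H0_L2 H0h; have L1 := H0_L2 H1h.
have L2' := H0_L2 H2h; have L12 := H0_L2 H12h.
have etak k : k \in L2 ->
    ip eta k = ip (c0 h) k + ip (c1 h) k + ip (c2 h) k + ip (c12 h) k.
  move=> Lk; rewrite -!ipDl ?L2D//; apply: ae_eq_ip => //.
  by rewrite !L2D.
have [P1h P1] := proj_spec s1 L2'; have [P2h P2] := proj_spec s2 L1.
split.
- rewrite -H0_sempty; apply: proj_uniq => // k Hk.
  rewrite etak ?(H0_L2 Hk)// (H0_orth sempty_proper1 H1h Hk).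
  rewrite (H0_orth sempty_proper2 H2h Hk) (H0_orth sempty_proper12 H12h Hk).
  by rewrite !addr0.
- apply: proj_uniq => //; first exact: subspaceD (H0_subspace s1) H1h P1h.
  move=> k Hk; have Lk := H0_L2 Hk.
  rewrite etak// (ipC _ (c0 h)) (H0_orth sempty_proper1 Hk H0h).
  by rewrite (H0_orth s1_proper H12h Hk) add0r addr0 ipDl ?P1// (H0_L2 P1h).
- apply: proj_uniq => //; first exact: subspaceD (H0_subspace s2) P2h H2h.
  move=> k Hk; have Lk := H0_L2 Hk.
  rewrite etak// (ipC _ (c0 h)) (H0_orth sempty_proper2 Hk H0h).
  by rewrite (H0_orth s2_proper H12h Hk) add0r addr0 ipDl ?P2// (H0_L2 P2h).
- apply: proj_uniq => // k Hk; have Lk := H0_L2 Hk.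
  rewrite etak// (ipC _ (c0 h)) (H0_orth sempty_proper12 Hk H0h).
  rewrite (ipC _ (c1 h)) (H0_orth s1_proper Hk H1h).
  by rewrite (ipC _ (c2 h)) (H0_orth s2_proper Hk H2h) !add0r.
Qed.

(** The rows for H_1^0 and H_2^0 give the orthogonality of the difference of the
sums c1 + c2 to both spaces, hence to itself. *)
Lemma system_unique eta h h' :
  in_H0_product X h -> in_H0_product X h' ->
  system_S X eta h -> system_S X eta h' -> components_ae_eq X h h'.
Proof.
move=> /in_H0_productP[_ H1 H2 _] /in_H0_productP[_ H1' H2' _].
move=> [e0 e1 e2 e12] [e0' e1' e2' e12'].
have ae_trans (f g k : plane R -> R) :
    f = k %[ae Q] -> g = k %[ae Q] -> f = g %[ae Q].
  by apply: filterS2 => x fk gk _; rewrite fk// gk.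
have L1 := H0_L2 H1; have L1' := H0_L2 H1'.
have L2' := H0_L2 H2; have L2'' := H0_L2 H2'.
have [P1h P1] := proj_spec s1 L2'; have [P1h' P1'] := proj_spec s1 L2''.
have [P2h P2] := proj_spec s2 L1; have [P2h' P2'] := proj_spec s2 L1'.
have D1 := subspaceB (H0_subspace s1) H1 H1'.
have D2 := subspaceB (H0_subspace s2) H2 H2'.
have LD1 := H0_L2 D1; have LD2 := H0_L2 D2.
have orth1 k : H0 X s1 k -> ip ((c1 h - c1 h') + (c2 h - c2 h')) k = 0.
  move=> Hk; have Lk := H0_L2 Hk.
  rewrite ipDl// !ipBl// addrACA -opprD -P1// -P1'//.
  have := ae_eq_ip (L2D L1 (H0_L2 P1h)) (L2D L1' (H0_L2 P1h')) Lk
    (ae_trans _ _ _ e1 e1').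
  by rewrite !ipDl ?(H0_L2 P1h) ?(H0_L2 P1h')// => ->; rewrite subrr.
have orth2 k : H0 X s2 k -> ip ((c1 h - c1 h') + (c2 h - c2 h')) k = 0.
  move=> Hk; have Lk := H0_L2 Hk.
  rewrite ipDl// !ipBl// addrACA -opprD -P2// -P2'//.
  have := ae_eq_ip (L2D (H0_L2 P2h) L2') (L2D (H0_L2 P2h') L2'') Lk
    (ae_trans _ _ _ e2 e2').
  by rewrite !ipDl ?(H0_L2 P2h) ?(H0_L2 P2h')// => ->; rewrite subrr.
have [n1 n2] : nrm2 (c1 h - c1 h') = 0 /\ nrm2 (c2 h - c2 h') = 0.
  apply: sum_nrm2_eq0 => //.
  by rewrite (ipDr LD1 LD2 (L2D LD1 LD2)) orth1// orth2// addr0.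
split; [exact: ae_trans e0 e0'|exact: nrm2_eq0P|exact: nrm2_eq0P|].
exact: ae_trans e12 e12'.
Qed.

End ambient.
End joint_law.

Theorem proposition7 (R : realType) (d : measure_display)
    (Omega : measurableType d) (P : probability Omega R)
    (X : {RV P >-> plane R})
    (nu1 nu2 : {sigma_finite_measure set (measurableTypeR R) -> \bar R})
    (PX_nu : distribution P X `<< nu_prod nu1 nu2)
    (M : R) (M_gt0 : 0 < M) (M_le1 : M <= 1)
    (pX_ge : forall u : {set 'I_2}, \forall x \ae (nu_prod nu1 nu2),
       (M%:E * (marginal_density X nu1 nu2 u x *
                marginal_density X nu1 nu2 (~: u)%SET x)
        <= ('d (charge_of_finite_measure (distribution P X))
             '/d (nu_prod nu1 nu2)) x)%E)
    (eta : plane R -> R) (eta_L2 : eta \in Lfun (distribution P X) 2%:E) :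
  exists hs : components R,
    [/\ hierarchical_decomposition X eta hs,
        forall h, hierarchical_decomposition X eta h -> components_ae_eq X h hs,
        system_S X eta hs &
        forall h, in_H0_product X h -> system_S X eta h -> components_ae_eq X h hs].
Proof.
(* the case u = {1} of the density bound *)
have pX_ge1 : \forall x \ae (nu_prod nu1 nu2),
   (M%:E *
     (('d (charge_of_finite_measure
             (distribution (distribution P X) (@coord1 R))) '/d nu1) x.1 *
      ('d (charge_of_finite_measure
             (distribution (distribution P X) (@coord2 R))) '/d nu2) x.2)
    <= ('d (charge_of_finite_measure (distribution P X))
          '/d (nu_prod nu1 nu2)) x)%E.
  by have := pX_ge s1; rewrite /marginal_density !inE.
have [hs hsP] := decomposition_exists PX_nu M_gt0 pX_ge1 eta_L2.
have hsS := decomposition_solves eta_L2 hsP.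
exists hs; split=> // [h hP|h hp hS].
- have hS := decomposition_solves eta_L2 hP.
  exact: (system_unique PX_nu M_gt0 pX_ge1 hP.1 hsP.1 hS hsS).
- exact: (system_unique PX_nu M_gt0 pX_ge1 hp hsP.1 hS hsS).
Qed.
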